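(* Let $\Lambda=(\lambda_n)_{n\ge 1}$ be a non-decreasing sequence of positive reals tending to infinity with $\lambda_1=1$ and $\lambda_{n+1}\le\lambda_n+1$, and let $M$ be an Orlicz function. Let $p=(p_k)$ and $q=(q_k)$ be real sequences with $1\le p_k\le q_k$ for all $k$ and with $\left(\frac{q_k}{p_k}\right)$ bounded. Then $[V,\lambda,M,\widehat F,q]^G\subset[V,\lambda,M,\widehat F,p]^G$.
   Context: An Orlicz function is a continuous, convex, non-decreasing function $M:[0,\infty)\to[0,\infty)$ with $M(0)=0$ and $M(x)>0$ for $x>0$. $I_n$ is the set of integers $k$ with $n-\lambda_n+1\le k\le n$. The Fibonacci numbers are $f_0=f_1=1$, $f_n=f_{n-1}+f_{n-2}$ for $n\ge2$. Geometric arithmetic: $\mathbb C(G)=\{e^z:z\in\mathbb C\}$, where elements are handled through their exponents ($e^z$ and $e^w$ are the same element iff $z=w$), with $e^z\oplus e^w=e^{z+w}$, $e^z\ominus e^w=e^{z-w}$, $e^z\odot e^w=e^{zw}$; this is a field with zero $1=e^0$ and identity $e=e^1$. The geometric modulus is $|e^z|_G=e^{|z|}$. In the definitions below all arithmetic is geometric: for real $c$, $c\,e^z$ means $e^{cz}$; for $a\ge0$ and $\rho=e^r>1$, $e^a/\rho$ means $e^{a/r}$; $M(e^a)$ means $e^{M(a)}$; $(e^a)^{p^G}$ means $e^{a^p}$; $G\sum_k e^{a_k}=e^{\sum_k a_k}$; $G\lim_n e^{a_n}=e^{\lim_n a_n}$. $\omega(G)$ is the set of all sequences $x=(x_k)_{k\ge0}$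 in $\mathbb C(G)$. For $x\in\omega(G)$ and $k\ge1$ put $y_k=\frac{f_k}{f_{k+1}}x_k\ominus\frac{f_{k+1}}{f_k}x_{k-1}$. For a sequence $p=(p_k)$ of strictly positive reals define $[V,\lambda,M,\widehat F,p]^G=\{x\in\omega(G): G\lim_{n}\frac1{\lambda_n}G\sum_{k\in I_n}[M(|y_k\ominus\ell|_G/\rho)]^{p_k^G}=1\text{ for some }\ell\in\mathbb C(G),\ \rho>1\}$, and $[V,\lambda,M,\widehat F,q]^G$ in the same way with $q_k$ in place of $p_k$. In exponents, with $x_k=e^{z_k}$, $w_k=\frac{f_k}{f_{k+1}}z_k-\frac{f_{k+1}}{f_k}z_{k-1}$, $\ell=e^L$, $\rho=e^r$: the condition is $\frac1{\lambda_n}\sum_{k\in I_n}M(|w_k-L|/r)^{p_k}\to0$ for some $L\in\mathbb C$, $r>0$. *)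

(* Defs.v *)
From mathcomp Require Import all_boot all_order all_algebra.
From mathcomp Require Import complex.
From mathcomp Require Import all_classical all_reals all_analysis.

Set Implicit Arguments.
Unset Strict Implicit.
Unset Printing Implicit Defensive.

Import Order.TTheory GRing.Theory Num.Theory.
Import numFieldNormedType.Exports.
Local Open Scope classical_set_scope.
Local Open Scope ring_scope.

(* [GExp z] is the geometric complex number e^z.  It is a formal exponential:
   e^z and e^w are the same element iff z = w. *)
Record geomC (R : realType) := GExp { gexponent : R[i] }.

(* Geometric real numbers e^a (a real) are the genuine positive reals [expR a];
   the exponent of a geometric real x is [ln x].  The operations below are only
   meant for positive arguments. *)
Section GeometricArithmetic.
Variable R : realType.
Implicit Types (x y : geomC R) (a b r c : R).

Definition gsub x y : geomC R := GExp (gexponent x - gexponent y).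

Definition gscale c x : geomC R := GExp (c%:C%C * gexponent x).

Definition gmod x : R := expR (Normc.normc (gexponent x)).

Definition gdiv_real a r : R := expR (ln a / ln r).

Definition gscale_real c a : R := expR (c * ln a).

Definition gapp (M : R -> R) a : R := expR (M (ln a)).

Definition gpow a p : R := expR (ln a `^ p).

Definition gsum (n : nat) (P : pred nat) (a : nat -> R) : R :=
  expR (\sum_(0 <= k < n | P k) ln (a k)).

Definition glim_is (a : nat -> R) (l : R) : Prop :=
  ln (a n) @[n --> \oo] --> ln l.

End GeometricArithmetic.

(* M : [0, +oo[ -> [0, +oo[, represented by a total function on R of which only
   the values on [0, +oo[ matter. *)
Definition orlicz_function (R : realType) (M : R -> R) : Prop :=
  [/\ (forall x, 0 <= x -> 0 <= M x),
      {within [set` `[0, +oo[], continuous M},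
      convex_function ([set` `[0, +oo[] : set (convex_lmodType R^o)) M,
      {in `[0, +oo[ &, {homo M : x y / x <= y}}
    & M 0 = 0 /\ (forall x, 0 < x -> 0 < M x)].

Fixpoint fib (n : nat) : nat :=
  if n is n1.+1 then (if n1 is n2.+1 then fib n1 + fib n2 else 1)%N else 1%N.

Section Space.
Variable R : realType.
Implicit Types (lam p : nat -> R) (M : R -> R) (x : nat -> geomC R).

(* Only meaningful for k >= 1. *)
Definition Fhat x (k : nat) : geomC R :=
  gsub (gscale ((fib k)%:R / (fib k.+1)%:R) (x k))
       (gscale ((fib k.+1)%:R / (fib k)%:R) (x k.-1)).

(* When lam n <= n, every member of I_n is >= 1, so indexing by natural numbers
   loses nothing. *)
Definition I_ lam (n : nat) : pred nat :=
  fun k => (n%:R - lam n + 1 <= k%:R) && (k <= n)%N.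

Definition VlamMF lam M p : set (nat -> geomC R) :=
  [set x | exists (l : geomC R) (rho : R), 1 < rho /\
     glim_is (fun n => gscale_real (lam n)^-1
       (gsum n.+1 (I_ lam n)
         (fun k => gpow (gapp M (gdiv_real (gmod (gsub (Fhat x k) l)) rho))
                        (p k)))) 1].

End Space.

(* Main.v *)
(** Writing [t_k = M(|w_k - L|/r)^{q_k}] and [mu_k = p_k/q_k], the two averages are
    those of [t_k] and of [t_k^{mu_k}], with [1/B <= mu_k <= 1]. For [0 < m <= 1],
    [t^mu <= m + t / m^B]: either [t <= m^B], and [t^mu <= m^(B mu) <= m], or
    [t > m^B], and [t^mu <= (t / m^B)^mu <= t / m^B]. Since [I_n] has at most
    [lambda_n] elements, the average of the [t_k^{mu_k}] is at most [m] plus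
    [m^{-B}] times the average of the [t_k]; let [n] tend to infinity, then [m] to 0. *)

Require Import Defs.
From mathcomp Require Import all_boot all_order all_algebra.
From mathcomp Require Import complex.
From mathcomp Require Import zify lra.
From mathcomp Require Import all_classical all_reals all_analysis.
Set Implicit Arguments.
Unset Strict Implicit.
Unset Printing Implicit Defensive.
Import Order.TTheory GRing.Theory Num.Theory.
Import numFieldNormedType.Exports.
Local Open Scope classical_set_scope.
Local Open Scope ring_scope.

Lemma powR_le_add_div (R : realType) (m B mu t : R) :
  0 < m <= 1 -> 0 <= B -> 0 <= mu <= 1 -> 1 <= B * mu -> 0 <= t ->
  t `^ mu <= m + t / m `^ B.
Proof.
move=> /andP[m0 m1] B0 /andP[mu0 mu1] Bmu t0.
have s0 : 0 < m `^ B by exact: powR_gt0.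
have s1 : m `^ B <= 1.
  by rewrite -(powRr0 m) ger_powR ?m0.
have [ts|st] := leP t (m `^ B).
  rewrite (@le_trans _ _ m) ?lerDl ?divr_ge0 ?(ltW s0)//.
  apply: (@le_trans _ _ ((m `^ B) `^ mu)).
    by apply: ge0_ler_powR => //; rewrite nnegrE // ltW.
  by rewrite -powRrM -{2}(powRr1 (ltW m0)) ger_powR ?m0.
have ts1 : 1 <= t / m `^ B by rewrite ler_pdivlMr// mul1r ltW.
apply: (@le_trans _ _ (t / m `^ B)); last by rewrite lerDr ltW.
apply: (@le_trans _ _ ((t / m `^ B) `^ mu)).
  apply: ge0_ler_powR => //; rewrite ?nnegrE ?divr_ge0 ?(ltW s0)//.
  by rewrite ler_pdivlMr// ler_piMr.
by rewrite -{2}(powRr1 (le_trans ler01 ts1)) ler_powR.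
Qed.

(** For an index k of I_n, the integer n - k + 1 is at most [lam n], hence at most its integer part
    [m]. So k is among the last [m] integers up to n. *)
Lemma card_I_le (R : realType) (lam : nat -> R) n :
  0 <= lam n -> \sum_(0 <= k < n.+1 | I_ lam n k) (1 : R) <= lam n.
Proof.
move=> lam0; set m := Num.truncn (lam n).
have mlam : m%:R <= lam n by rewrite truncn_le.
apply: le_trans mlam.
apply: (@le_trans _ _ (\sum_(0 <= k < n.+1 | (n.+1 - m <= k)%N) (1 : R))).
  rewrite big_mkcond [leRHS]big_mkcond /=; apply: ler_sum => k _.
  case: ifPn => [/andP[nk kn]|_]; last by case: ifP.
  suff -> : (n.+1 - m <= k)%N by [].
  rewrite leq_subLR addnC -leq_subLR subSn// /m truncn_ge_nat//.
  by rewrite -natr1 natrB//; lra.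
rewrite -(big_nat_widenl (n.+1 - m) 0 n.+1 predT)//.
(* Subtraction on naturals is truncated: for [m] above n + 1 the count is n + 1, still at most
   [m]. *)
by rewrite sumr_const_nat ler_nat; lia.
Qed.

Lemma lam_le_nat (R : realType) (lam : nat -> R) :
  lam 1%N = 1 -> (forall n, (1 <= n)%N -> lam n.+1 <= lam n + 1) ->
  forall n, (1 <= n)%N -> lam n <= n%:R.
Proof.
move=> lam1 lam_step; elim=> [//|[|n] IHn] _; first by rewrite lam1.
by rewrite (le_trans (lam_step _ _))// -[leRHS]natr1 lerD2r IHn.
Qed.

(** Sums start at k = 0, but the conditions on [p] and [q] only concern k >= 1; this excludes the
    index 0. *)
Lemma I_gt0 (R : realType) (lam : nat -> R) n k :
  lam n <= n%:R -> I_ lam n k -> (1 <= k)%N.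
Proof.
by move=> lamn /andP[nk _]; rewrite -(ler_nat R); lra.
Qed.

(** Passage to exponents: each geometric operation is [expR] of an ordinary one on logarithms, so
    all inner pairs of [ln] and [expR] cancel, and the limit 1 becomes ln 1 = 0. *)
Lemma glim_averageE (R : realType) (lam : nat -> R) (M : R -> R) (p : nat -> R)
    (a : nat -> R) :
  glim_is (fun n => gscale_real (lam n)^-1
    (gsum n.+1 (I_ lam n) (fun k => gpow (gapp M (a k)) (p k)))) 1 =
  ((lam n)^-1 * (\sum_(0 <= k < n.+1 | I_ lam n k) M (ln (a k)) `^ p k)
    @[n --> \oo] --> 0).
Proof.
rewrite /glim_is ln1.
suff /funext -> : (fun n => ln (gscale_real (lam n)^-1
    (gsum n.+1 (I_ lam n) (fun k => gpow (gapp M (a k)) (p k))))) =1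
  (fun n => (lam n)^-1 *
    (\sum_(0 <= k < n.+1 | I_ lam n k) M (ln (a k)) `^ p k)) by [].
move=> n; rewrite /gscale_real /gsum !expRK; congr (_ * _).
by apply: eq_bigr => k _; rewrite /gpow /gapp !expRK.
Qed.

Lemma average_powR_cvg0 (R : realType) (lam : nat -> R) (a p q : nat -> R) (B : R) :
  (forall n, (1 <= n)%N -> 0 < lam n <= n%:R) ->
  (forall k, (1 <= k)%N -> 0 < p k <= q k) ->
  (forall k, (1 <= k)%N -> q k / p k <= B) ->
  (lam n)^-1 * (\sum_(0 <= k < n.+1 | I_ lam n k) a k `^ q k)
    @[n --> \oo] --> 0 ->
  (lam n)^-1 * (\sum_(0 <= k < n.+1 | I_ lam n k) a k `^ p k)
    @[n --> \oo] --> 0.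
Proof.
move=> lamP pq qpB Fq; apply/cvgr0Pnorm_lt => /= e e0.
(* Half of [e] is spent on [m]; the cap at 1 is what [powR_le_add_div] requires. *)
pose m := Num.min 1 (e / 2).
have m0 : 0 < m by rewrite lt_min ltr01 divr_gt0.
have m1 : m <= 1 by rewrite ge_min lexx.
have me : m <= e / 2 by rewrite ge_min lexx orbT.
have s0 : 0 < m `^ B by exact: powR_gt0.
have B0 : 0 <= B.
  have /andP[p0 pleq] := pq 1%N isT.
  by apply: le_trans (qpB 1%N isT); rewrite divr_ge0// ltW// (lt_le_trans p0).
(* This tolerance leaves the other e / 2 after division by m^B. *)
move/cvgr0Pnorm_lt: Fq => /(_ (m `^ B * (e / 2))) Fq.
have /Fq F_small : 0 < m `^ B * (e / 2) by rewrite mulr_gt0// divr_gt0.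
near=> n.
have n1 : (1 <= n)%N by near: n; exact: nbhs_infty_ge.
have /andP[lam0 lamn] := lamP n n1.
have : `|(lam n)^-1 * (\sum_(0 <= k < n.+1 | I_ lam n k) a k `^ q k)|
    < m `^ B * (e / 2).
  by near: n; exact: F_small.
have ge0 (r : nat -> R) :
    0 <= (lam n)^-1 * (\sum_(0 <= k < n.+1 | I_ lam n k) a k `^ r k).
  by rewrite mulr_ge0 ?invr_ge0 ?(ltW lam0)// sumr_ge0// => k _; exact: powR_ge0.
rewrite !ger0_norm//; set Sq := _ * _ => Sq_small.
have le_mS : (lam n)^-1 * (\sum_(0 <= k < n.+1 | I_ lam n k) a k `^ p k)
    <= m + Sq / m `^ B.
  rewrite /Sq -mulrA mulrC ler_pdivrMr// mulrDl mulrAC mulVf ?gt_eqF// mul1r.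
  (* The factor 1 in [m * 1] makes the first part of the sum [m] times the cardinality of I_n. *)
  apply: (@le_trans _ _
    (\sum_(0 <= k < n.+1 | I_ lam n k) (m * 1 + a k `^ q k / m `^ B))).
    apply: ler_sum => k /(I_gt0 lamn) k1.
    have /andP[p0 pleq] := pq k k1; have q0 := lt_le_trans p0 pleq.
    (* Writing p_k as q_k (p_k / q_k) exhibits the term as t^mu with t = a_k^(q_k) and mu = p_k /
       q_k. *)
    rewrite mulr1 -{1}(@divfK _ (q k) _ (p k)) ?gt_eqF// [_ * q k]mulrC powRrM.
    apply: powR_le_add_div => //; rewrite ?m0 ?powR_ge0//.
      by rewrite divr_ge0 ?(ltW p0) ?(ltW q0)// ler_pdivrMr// mul1r.
    by rewrite mulrA ler_pdivlMr// mul1r -ler_pdivrMr// qpB.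
  rewrite big_split/= -mulr_sumr -mulr_suml lerD2r.
  by rewrite ler_pM2l// card_I_le// ltW.
apply: (le_lt_trans le_mS).
have : Sq / m `^ B < e / 2 by rewrite ltr_pdivrMr// mulrC.
by move: me; lra.
Unshelve. all: by end_near. Qed.

Theorem theorem4p4 (R : realType) (lam : nat -> R) (M : R -> R)
  (p q : nat -> R)
  (lam_gt0 : forall n, (1 <= n)%N -> 0 < lam n)
  (lam_nondecreasing :
     forall m n, (1 <= m)%N -> (m <= n)%N -> lam m <= lam n)
  (lam_oo : lam n @[n --> \oo] --> +oo)
  (lam1 : lam 1%N = 1)
  (lam_step : forall n, (1 <= n)%N -> lam n.+1 <= lam n + 1)
  (M_orlicz : orlicz_function M)
  (pq : forall k, (1 <= k)%N -> 1 <= p k /\ p k <= q k)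
  (qp_bounded : exists B : R, forall k, (1 <= k)%N -> `|q k / p k| <= B) :
  VlamMF lam M q `<=` VlamMF lam M p.
Proof.
have [B qpB] := qp_bounded.
move=> x [l [rho [rho1]]]; rewrite glim_averageE => xq.
(* The limit and the scale found for [q] serve for [p] too. *)
exists l, rho; split; first exact: rho1.
rewrite glim_averageE; move: xq.
apply: (@average_powR_cvg0 _ _ _ _ _ B) => [n n1|k k1|k k1].
- by rewrite lam_gt0//= (lam_le_nat lam1 lam_step).
- by have [p1 ->] := pq k k1; rewrite (lt_le_trans ltr01 p1).
- exact: le_trans (ler_norm _) (qpB k k1).
Qed.
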